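(* Let $\alpha\in(0,1)$. (One-sided case) Consider a sequence of one-sided GOF tests $\varphi_n$ with critical values $0\le c_{1,n}<\dots<c_{n,n}<1$ such that $\lim_{n\to\infty}\mathbb{E}_0(\varphi_n)=\alpha$, and let $\alpha_{i,n}$, $i=1,\dots,n$, be its local levels. Then $$\lim_{n\to\infty}\min_{1\le i\le n}\alpha_{i,n}=0 .$$ (Two-sided case) Consider a sequence of two-sided GOF tests $\tilde\varphi_n$ with critical values $0\le c_{1,n}<\dots<c_{n,n}<1$ and $0<\tilde c_{1,n}<\dots<\tilde c_{n,n}\le 1$ with $c_{i,n}<\tilde c_{i,n}$, $i=1,\dots,n$, such that $\lim_{n\to\infty}\mathbb{E}_0(\tilde\varphi_n)=\alpha$, and let $\alpha^{=}_{i,n}$, $i=1,\dots,n$, be its local levels. Then $$\lim_{n\to\infty}\min_{1\le i\le n}\alpha^{=}_{i,n}=0 .$$ Thus, it is impossible to construct an asymptotic level $\alpha$ GOF test with local levels which are all asymptotically bounded away from zero.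
   Context: Let $X_1,\dots,X_n$ be i.i.d. with values in $[0,1]$, with order statistics $X_{1:n}\le\dots\le X_{n:n}$, and let $U_{1:n}\le\dots\le U_{n:n}$ be the order statistics of $n$ i.i.d. random variables uniformly distributed on $[0,1]$. A one-sided goodness of fit (GOF) test $\varphi_n\in\{0,1\}$ with critical values $c_{i,n}$ is defined by: $\varphi_n=1$ iff $X_{i:n}\le c_{i,n}$ for at least one $i=1,\dots,n$. A two-sided GOF test $\tilde\varphi_n\in\{0,1\}$ is defined by: $\tilde\varphi_n=1$ iff $X_{i:n}\le c_{i,n}$ or $X_{i:n}\ge\tilde c_{i,n}$ for at least one $i=1,\dots,n$. $\mathbb{E}_0$ denotes expectation when the $X_i$ are uniformly distributed on $[0,1]$, so $\mathbb{E}_0(\varphi_n)$, $\mathbb{E}_0(\tilde\varphi_n)$ are the probabilities of rejection under the null hypothesis. The local levels are $\alpha_{i,n}=\mathbb{P}(U_{i:n}\le c_{i,n})$ in the one-sided case and $\alpha^{=}_{i,n}=\mathbb{P}(U_{i:n}\le c_{i,n})+\mathbb{P}(U_{i:n}\ge\tilde c_{i,n})$ in the two-sided case. A test (sequence) is of asymptotic level $\alpha$ if its rejection probability under the null converges to $\alpha$. *)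

(* Defs.v *)
From HB Require Import structures.
From mathcomp Require Import all_boot all_order all_algebra.
From mathcomp Require Import all_classical all_reals all_analysis.

Set Implicit Arguments.
Unset Strict Implicit.
Unset Printing Implicit Defensive.

Import Order.TTheory GRing.Theory Num.Theory.
Import numFieldNormedType.Exports.

Local Open Scope classical_set_scope.
Local Open Scope ring_scope.

Definition mutually_independent (R : realType) (d : measure_display)
    (T : measurableType d) (P : probability T R) (n : nat)
    (X : 'I_n -> {RV P >-> R}) : Prop :=
  forall (J : {set 'I_n}) (B : 'I_n -> set R), (forall i, measurable (B i)) ->
    P [set w | forall i, i \in J -> B i (X i w)] =
      (\prod_(i in J) P (X i @^-1` B i))%E.

(* The two laws are only compared on Borel sets: as Rocq functions they are
   also defined on non-measurable sets, where their values are meaningless. *)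
Definition uniform01 (R : realType) (d : measure_display)
    (T : measurableType d) (P : probability T R) (X : {RV P >-> R}) : Prop :=
  forall A : set R, measurable A ->
    distribution P X A = uniform_prob (@ltr01 R) A.

Definition iid_uniform01 (R : realType) (d : measure_display)
    (T : measurableType d) (P : probability T R) (n : nat)
    (X : 'I_n -> {RV P >-> R}) : Prop :=
  mutually_independent X /\ (forall i, uniform01 (X i)).

(* Indices start at 0: the order statistic x_{i:n} is [order_stat x (i - 1)]. *)
Definition order_stat (R : realType) (n : nat) (x : 'I_n -> R) (i : 'I_n) : R :=
  nth 0 (sort <=%R [seq x j | j <- enum 'I_n]) i.

Definition one_sided_test (R : realType) (n : nat) (c x : 'I_n -> R) : bool :=
  [exists i, order_stat x i <= c i].

Definition two_sided_test (R : realType) (n : nat) (c c' x : 'I_n -> R) : bool :=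
  [exists i, (order_stat x i <= c i) || (c' i <= order_stat x i)].

Definition expected_test (R : realType) (d : measure_display)
    (T : measurableType d) (P : probability T R) (n : nat)
    (X : 'I_n -> {RV P >-> R}) (phi : ('I_n -> R) -> bool) : \bar R :=
  'E_P[fun w => (phi (fun i => X i w))%:R].

Definition local_level (R : realType) (d : measure_display)
    (T : measurableType d) (P : probability T R) (n : nat)
    (U : 'I_n -> {RV P >-> R}) (c : 'I_n -> R) (i : 'I_n) : \bar R :=
  P [set w | order_stat (fun j => U j w) i <= c i].

Definition local_level2 (R : realType) (d : measure_display)
    (T : measurableType d) (P : probability T R) (n : nat)
    (U : 'I_n -> {RV P >-> R}) (c c' : 'I_n -> R) (i : 'I_n) : \bar R :=
  (P [set w | (order_stat (fun j => U j w) i <= c i)%R] +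
   P [set w | (c' i <= order_stat (fun j => U j w) i)%R])%E.

(* +oo is neutral for the minimum, so this is the true minimum once n > 0. *)
Definition min_level (R : realType) (n : nat) (a : 'I_n -> \bar R) : \bar R :=
  \big[Order.min/+oo%E]_(i < n) a i.

Definition asymptotically_bounded_away (R : realType)
    (a : forall n, 'I_n -> \bar R) : Prop :=
  exists2 delta : R, 0 < delta &
    \forall n \near \oo, forall i : 'I_n, (delta%:E <= a n i)%E.

Definition one_sided_critical (R : realType) (n : nat) (c : 'I_n -> R) : Prop :=
  (forall i, 0 <= c i < 1) /\ (forall i j : 'I_n, (i < j)%N -> c i < c j).

Definition two_sided_critical (R : realType) (n : nat) (c c' : 'I_n -> R) : Prop :=
  [/\ one_sided_critical c,
      forall i, 0 < c' i <= 1,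
      forall i j : 'I_n, (i < j)%N -> c' i < c' j
    & forall i, c i < c' i].

(* Main.v *)
Require Import Defs.
From HB Require Import structures.
From mathcomp Require Import all_boot all_order all_algebra.
From mathcomp Require Import all_classical all_reals all_analysis.
From mathcomp Require Import ring lra.

Set Implicit Arguments.
Unset Strict Implicit.
Unset Printing Implicit Defensive.

Import Order.TTheory GRing.Theory Num.Theory.
Import numFieldNormedType.Exports.

Local Open Scope classical_set_scope.
Local Open Scope ring_scope.

(** If all local levels at sample size [n] are at least [delta], the test rejects
    with probability close to 1 when [n] is large; since the rejection
    probability tends to [alpha < 1], this cannot happen for infinitely many
    [n]. The reason is that order statistics of geometrically growing ranks are
    almost independent, so that the test contains many almost independent
    chances of rejection, each of probability at least [delta].

    The comparison of the order statistic of rank [r] with a critical value [t]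
    is a statement on the number of sample points below [t], which is binomial
    ([crossing_order_stat], [prob_crossing]). For two thresholds [t < t'] the
    pair of counts is a sum of [n] independent copies of a pair of nested
    indicators. Maximal correlation does not increase under such sums
    ([nested_cov]), hence any event on the first count and any event on the
    second one have covariance at most [rho] as soon as [t <= rho ^ 2 * t']
    ([nested_cov_ind]).

    It remains to know that thresholds of distant ranks are far apart. Critical
    values need not behave this way, but [balanced_threshold] replaces each of
    them by one for which [n t] is of order [r], at the price of making rejection
    rarer, and without losing the lower bound [delta] on its level. At the ranks
    [M ^ k], [k < m], the second moment method then bounds the probability that
    no rejection occurs by [(1 / m + rho) / delta ^ 2]
    ([crossing_unavoidable]).

    In the two-sided case, one of the two events of each index carries at least
    half of its local level, and only this one is kept. *)

(** * Binomial means and pairs of nested counts *)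

(** The expectation of [f k] when [k] counts the successes of [n] independent
    trials of probability [p]. The recursion splits on the outcome of one trial,
    so that every identity below is an induction with two branches. *)
Fixpoint bin_mean (R : realFieldType) (p : R) (n : nat) (f : nat -> R) : R :=
  if n is n'.+1 then
    p * bin_mean p n' (fun k => f k.+1) + (1 - p) * bin_mean p n' f
  else f 0%N.

(** The expectation of [F a b] when [a] and [b] count the points of an
    independent sample of size [n] in two nested sets of probabilities
    [p <= q]: a point is in both, in the larger one only, or in none. *)
Fixpoint nested_mean (R : realFieldType) (p q : R) (n : nat)
    (F : nat -> nat -> R) : R :=
  if n is n'.+1 then
    p * nested_mean p q n' (fun a b => F a.+1 b.+1) +
    (q - p) * nested_mean p q n' (fun a b => F a b.+1) +
    (1 - q) * nested_mean p q n' F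
  else F 0%N 0%N.

Lemma nested_meanl (R : realFieldType) (p q : R) n (f : nat -> R) :
  nested_mean p q n (fun a _ => f a) = bin_mean p n f.
Proof. by elim: n f => //= n IH f; rewrite !IH; ring. Qed.

Lemma ler_bin_mean (R : realFieldType) (p : R) n (f g : nat -> R) :
  0 <= p <= 1 -> (forall k, f k <= g k) -> bin_mean p n f <= bin_mean p n g.
Proof.
move=> /andP[p0 p1]; elim: n f g => //= n IH f g fg.
by apply: lerD; apply: ler_wpM2l; rewrite ?subr_ge0 //; apply: IH => k.
Qed.

Lemma bin_meanZ (R : realFieldType) (p : R) n a (f : nat -> R) :
  bin_mean p n (fun k => a * f k) = a * bin_mean p n f.
Proof. by elim: n f => //= n IH f; rewrite !IH; ring. Qed.

Lemma eq_bin_mean (R : realFieldType) (p : R) n (f g : nat -> R) :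
  f =1 g -> bin_mean p n f = bin_mean p n g.
Proof.
elim: n f g => //= n IH f g fg; congr (_ * _ + _ * _); apply: IH => k //.
Qed.

Lemma bin_mean1B (R : realFieldType) (p : R) n (f : nat -> R) :
  bin_mean p n (fun k => 1 - f k) = 1 - bin_mean p n f.
Proof. by elim: n f => //= n IH f; rewrite !IH; ring. Qed.

Lemma bin_mean_id (R : realFieldType) (p : R) n (x : R) :
  bin_mean p n (fun k => k%:R + x) = n%:R * p + x.
Proof.
elim: n x => [|n IH] x /=; first by ring.
rewrite (@eq_bin_mean _ _ _ _ (fun k => k%:R + (1 + x))) => [|k].
  by rewrite !IH -natr1; ring.
by rewrite -natr1; ring.
Qed.

Lemma bin_mean_sqr (R : realFieldType) (p : R) n (x : R) :
  bin_mean p n (fun k => (k%:R + x) ^+ 2) =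
  (n%:R * p + x) ^+ 2 + n%:R * p * (1 - p).
Proof.
elim: n x => [|n IH] x /=; first by ring.
rewrite (@eq_bin_mean _ _ _ _ (fun k => (k%:R + (1 + x)) ^+ 2)) => [|k].
  by rewrite !IH -natr1; ring.
by rewrite -natr1; ring.
Qed.

(** Markov's inequality for the binomial law, with the denominator cleared. *)
Lemma bin_markov (R : realFieldType) (p : R) n r :
  0 <= p <= 1 -> r%:R * bin_mean p n (fun k => (r <= k)%N%:R) <= n%:R * p.
Proof.
move=> p01; rewrite -bin_meanZ -[leRHS]addr0 -bin_mean_id.
apply: ler_bin_mean => // k; rewrite addr0.
by case: leqP => rk; rewrite ?mulr1 ?mulr0 ?ler_nat ?ler0n.
Qed.

(** Chebyshev's inequality for the lower tail, with the denominator cleared and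
    the variance [n p (1 - p)] bounded by [n p]. *)
Lemma bin_chebyshev (R : realFieldType) (p : R) n r :
  0 <= p <= 1 -> r%:R <= n%:R * p ->
  (n%:R * p - r%:R) ^+ 2 * bin_mean p n (fun k => (k < r)%N%:R) <= n%:R * p.
Proof.
move=> p01 rnp; rewrite -bin_meanZ.
apply: (@le_trans _ _ (bin_mean p n (fun k => (k%:R + - (n%:R * p)) ^+ 2))).
  apply: ler_bin_mean => // k; case: ltnP => kr; rewrite ?mulr1 ?mulr0 ?sqr_ge0 //.
  rewrite -sqrrN opprB; move: kr; rewrite -(ltr_nat R).
  by set a := k%:R; set b := r%:R; move=> ab; nra.
rewrite bin_mean_sqr subrr expr0n add0r.
by case/andP: p01 => p0 p1; have : 0 <= n%:R * p by [rewrite mulr_ge0]; nra.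
Qed.

(** The case of a single sample point. The indicators of two nested sets of
    probabilities [p <= q] have covariance [p (1 - q)], and [x], [y] are the
    increments of functions of these indicators. The inequality says that their
    correlation is at most [rho], in a form that is linear in covariance and
    variances: the geometric mean of the variances is replaced by the
    arithmetic one. *)
Lemma nested_pair_cov (R : realFieldType) (p q rho x y : R) :
  0 <= p <= q -> q <= 1 -> 0 < rho -> p <= rho ^+ 2 * q ->
  2 * x * y * (p * (1 - q)) <=
    rho * (x ^+ 2 * (p * (1 - p)) + y ^+ 2 * (q * (1 - q))).
Proof.
move=> /andP[p0 pq] q1 r0 pr.
have h : 2 * x * y * p <= rho * (x ^+ 2 * p + y ^+ 2 * q).
  rewrite -(ler_pM2l r0).
  have : 0 <= p * (rho * x - y) ^+ 2 by rewrite mulr_ge0 // sqr_ge0.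
  have : p * y ^+ 2 <= rho ^+ 2 * q * y ^+ 2 by rewrite ler_wpM2r ?sqr_ge0.
  by nra.
apply: le_trans (_ : rho * (x ^+ 2 * p + y ^+ 2 * q) * (1 - q) <= _).
  by rewrite (mulrA _ p) ler_wpM2r ?subr_ge0.
rewrite -mulrA ler_pM2l //.
have : x ^+ 2 * (p * (1 - q)) <= x ^+ 2 * (p * (1 - p)).
  by rewrite ler_wpM2l ?sqr_ge0 // ler_wpM2l //; lra.
lra.
Qed.

Definition bin_var (R : realFieldType) (p : R) n (f : nat -> R) : R :=
  bin_mean p n (fun k => f k ^+ 2) - bin_mean p n f ^+ 2.

(** Tensorization of the maximal correlation: functions of the two counts are no
    more correlated than functions of the two indicators of a single point.
    Conditioning on one point splits the covariance into the mean of the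
    conditional covariances, bounded by induction, and the covariance of the
    conditional means, bounded by [nested_pair_cov]; the variances split in the
    same way. The bound being linear in the variances, the two parts simply add
    up. *)
Lemma nested_cov (R : realFieldType) (p q rho : R) n (f g : nat -> R) :
  0 <= p <= q -> q <= 1 -> 0 < rho -> p <= rho ^+ 2 * q ->
  2 * (nested_mean p q n (fun a b => f a * g b)
       - bin_mean p n f * bin_mean q n g)
    <= rho * (bin_var p n f + bin_var q n g).
Proof.
move=> pq q1 r0 pr; have [p0 pq'] := andP pq.
rewrite /bin_var; elim: n f g => [|n IH] f g /=; first by rewrite !subrr; lra.
have h11 := ler_wpM2l p0 (IH (fun k => f k.+1) (fun k => g k.+1)).
have qp0 : 0 <= q - p by lra.
have h01 := ler_wpM2l qp0 (IH f (fun k => g k.+1)).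
have q0 : 0 <= 1 - q by lra.
have h00 := ler_wpM2l q0 (IH f g).
set a1 := bin_mean p n (fun k => f k.+1) in h11 *.
set a0 := bin_mean p n f in h01 h00 *.
set b1 := bin_mean q n (fun k => g k.+1) in h11 h01 *.
set b0 := bin_mean q n g in h00 *.
have h := nested_pair_cov (a1 - a0) (b1 - b0) pq q1 r0 pr.
lra.
Qed.

(** For events the variances are at most [1], and the bound on the covariance
    becomes [rho]. *)
Lemma nested_cov_ind (R : realFieldType) (p q rho : R) n (f g : pred nat) :
  0 <= p <= q -> q <= 1 -> 0 < rho -> p <= rho ^+ 2 * q ->
  nested_mean p q n (fun a b => (f a && g b)%:R) <=
  bin_mean p n (fun k => (f k)%:R) * bin_mean q n (fun k => (g k)%:R) + rho.
Proof.
move=> pq q1 r0 pr.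
have := nested_cov n (fun k => (f k)%:R) (fun k => (g k)%:R) pq q1 r0 pr.
have -> : nested_mean p q n (fun a b => (f a)%:R * (g b)%:R) =
  nested_mean p q n (fun a b => (f a && g b)%:R).
  elim: n f g => [|n IH] f g /=; rewrite -?natrM ?mulnb //.
  by rewrite (IH (fun k => f k.+1) (fun k => g k.+1)) (IH f (fun k => g k.+1)) IH.
have v (r : R) (h : pred nat) : bin_var r n (fun k => (h k)%:R) <= 1.
  rewrite /bin_var (@eq_bin_mean _ _ _ _ (fun k => (h k)%:R)) => [|k].
    set m := bin_mean _ _ _; have := sqr_ge0 (m - 1 / 2); nra.
  by case: (h k); rewrite ?expr1n ?expr0n.
have h1 := v p f; have h2 := v q g.
have : rho * (bin_var p n (fun k => (f k)%:R) +
    bin_var q n (fun k => (g k)%:R)) <= rho * 2.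
  by apply: ler_wpM2l; [exact: ltW | lra].
lra.
Qed.

(** * Balanced thresholds *)

Lemma bin_mean_lt (R : realFieldType) (p : R) n r :
  bin_mean p n (fun k => (k < r)%N%:R) = 1 - bin_mean p n (fun k => (r <= k)%N%:R).
Proof.
rewrite -bin_mean1B; apply: eq_bin_mean => k.
by case: leqP => _; rewrite ?subrr ?subr0.
Qed.

(** The threshold is cut down to [4 r / n] if it is larger. By Chebyshev's
    inequality the count then still reaches [r] with probability above [1 / 2],
    and Markov's inequality gives [n t' >= delta r]. *)
Lemma balanced_lower (R : realFieldType) (t delta : R) n r :
  (0 < r)%N -> (4 * r <= n)%N -> 0 <= t <= 1 -> 0 < delta <= 1 / 2 ->
  delta <= bin_mean t n (fun k => (r <= k)%N%:R) ->
  exists t', [/\ 0 <= t' <= 1, t' <= t,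
    delta <= bin_mean t' n (fun k => (r <= k)%N%:R),
    delta * r%:R <= n%:R * t' & delta * (n%:R * t') <= 4 * r%:R].
Proof.
move=> r0 rn t01 d01 dt; have [d0 d1] := andP d01.
have rR : 1 <= r%:R :> R by rewrite ler1n.
have nR : 4 * r%:R <= n%:R :> R by rewrite -natrM ler_nat.
have n0 : 0 < n%:R :> R by lra.
pose u : R := 4 * r%:R / n%:R.
have nu : n%:R * u = 4 * r%:R by rewrite mulrC divfK // gt_eqF.
have u01 : 0 <= u <= 1 by apply/andP; split; rewrite -(ler_pM2l n0) ?nu; lra.
exists (Num.min t u).
have lb : delta <= bin_mean (Num.min t u) n (fun k => (r <= k)%N%:R).
  case: (leP t u) => // _; have := @bin_chebyshev R u n r u01.
  rewrite nu bin_mean_lt => /(_ ltac:(lra)).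
  set b := bin_mean _ _ _; have -> : (4 * r%:R - r%:R) ^+ 2 = 9 * r%:R ^+ 2 :> R.
    by ring.
  have r2 : r%:R <= r%:R ^+ 2 :> R by nra.
  move=> h; rewrite leNgt; apply/negP => bd.
  have : r%:R ^+ 2 * (1 / 2) < r%:R ^+ 2 * (1 - b) by rewrite ltr_pM2l; lra.
  lra.
have t'01 : 0 <= Num.min t u <= 1 by case: (leP t u).
have := bin_markov n r t'01; move: lb; set b := bin_mean _ _ _ => lb bm.
have nt : n%:R * Num.min t u <= 4 * r%:R.
  by rewrite -nu ler_pM2l // ge_min lexx orbT.
have nt0 : 0 <= n%:R * Num.min t u by apply: mulr_ge0; [exact: ltW | case/andP: t'01].
by split=> //; [rewrite ge_min lexx | nra | nra].
Qed.

(** The threshold is raised to [r / (2 n)] if it is smaller. By Markov's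
    inequality the count then still stays below [r] with probability at least
    [1 / 2], and Chebyshev's inequality gives [n t' <= 4 r / delta]. *)
Lemma balanced_upper (R : realFieldType) (t delta : R) n r :
  (0 < r)%N -> (4 * r <= n)%N -> 0 <= t <= 1 -> 0 < delta <= 1 / 2 ->
  delta <= bin_mean t n (fun k => (k < r)%N%:R) ->
  exists t', [/\ 0 <= t' <= 1, t <= t',
    delta <= bin_mean t' n (fun k => (k < r)%N%:R),
    delta * r%:R <= n%:R * t' & delta * (n%:R * t') <= 4 * r%:R].
Proof.
move=> r0 rn t01 d01 dt; have [d0 d1] := andP d01.
have rR : 1 <= r%:R :> R by rewrite ler1n.
have nR : 4 * r%:R <= n%:R :> R by rewrite -natrM ler_nat.
have n0 : 0 < n%:R :> R by lra.
pose u : R := r%:R / 2 / n%:R.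
have nu : n%:R * u = r%:R / 2 by rewrite mulrC divfK // gt_eqF.
have u01 : 0 <= u <= 1 by apply/andP; split; rewrite -(ler_pM2l n0) ?nu; lra.
exists (Num.max t u).
have lb : delta <= bin_mean (Num.max t u) n (fun k => (k < r)%N%:R).
  case: (leP u t) => // _; have := @bin_markov R u n r u01.
  rewrite nu bin_mean_lt; set b := bin_mean _ _ _; nra.
have t'01 : 0 <= Num.max t u <= 1 by case: (leP t u).
have nt : r%:R / 2 <= n%:R * Num.max t u.
  by rewrite -nu ler_pM2l // le_max lexx orbT.
have := @bin_chebyshev R _ n r t'01; move: lb; set b := bin_mean _ _ _ => lb bm.
split=> //; [by rewrite le_max lexx | by nra | ].
rewrite leNgt; apply/negP => big.
have h2 : 2 * r%:R <= n%:R * Num.max t u by nra.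
have := bm ltac:(lra); set x := n%:R * _ in big h2 *.
have x0 : 0 < x by lra.
have h : x ^+ 2 <= 4 * (x - r%:R) ^+ 2 by nra.
have : (x - r%:R) ^+ 2 * delta <= (x - r%:R) ^+ 2 * b by rewrite ler_wpM2l ?sqr_ge0.
have : x ^+ 2 * delta <= 4 * (x - r%:R) ^+ 2 * delta by rewrite ler_wpM2r; lra.
have : 4 * x < x * (delta * x) by rewrite mulrC ltr_pM2l //; nra.
nra.
Qed.

(** A threshold can be replaced by one that makes the event at rank [r] rarer,
    though still of probability at least [delta], and whose expected count
    [n t'] is of order [r]. The boolean [s] tells the event that the count
    reaches [r] from its negation. *)
Lemma balanced_threshold (R : realFieldType) (s : bool) (t delta : R) n r :
  (0 < r)%N -> (4 * r <= n)%N -> 0 <= t <= 1 -> 0 < delta <= 1 / 2 ->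
  delta <= bin_mean t n (fun k => ((r <= k)%N == s)%:R) ->
  exists t', [/\ 0 <= t' <= 1, if s then t' <= t else t <= t',
    delta <= bin_mean t' n (fun k => ((r <= k)%N == s)%:R),
    delta * r%:R <= n%:R * t' & delta * (n%:R * t') <= 4 * r%:R].
Proof.
move=> r0 rn t01 d01.
have side p : bin_mean p n (fun k => ((r <= k)%N == s)%:R) =
    if s then bin_mean p n (fun k => (r <= k)%N%:R)
    else bin_mean p n (fun k => (k < r)%N%:R).
  by case: s; apply: eq_bin_mean => k; case: leqP.
rewrite side; case: s side => side dt.
  have [t' [h1 h2 h3 h4 h5]] := balanced_lower r0 rn t01 d01 dt.
  by exists t'; rewrite side.
have [t' [h1 h2 h3 h4 h5]] := balanced_upper r0 rn t01 d01 dt.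
by exists t'; rewrite side.
Qed.

(** * The second moment method *)

(** Chebyshev's inequality for the number [Z] of the events [A i] that occur: if
    none does, [Z] is away from its mean by the whole mean, which is at least
    [#|I| delta], and weak pairwise correlation keeps the variance small. *)
Lemma second_moment (R : realFieldType) (I T : finType) (mu : T -> R)
    (A : I -> pred T) (delta eta : R) :
  (forall x, 0 <= mu x) -> \sum_x mu x = 1 -> 0 < delta -> 0 <= eta ->
  (forall i, delta <= \sum_(x | A i x) mu x) ->
  (forall i j, i != j -> \sum_(x | A i x && A j x) mu x <=
     (\sum_(x | A i x) mu x) * (\sum_(x | A j x) mu x) + eta) ->
  (#|I|%:R * delta) ^+ 2 * \sum_(x | [forall i, ~~ A i x]) mu x <=
    #|I|%:R + #|I|%:R ^+ 2 * eta.
Proof.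
move=> mu0 mu1 d0 eta0 lb cov.
pose p i := \sum_(x | A i x) mu x; pose S := \sum_i p i.
pose Z x : R := \sum_i (A i x)%:R.
have EZ : \sum_x mu x * Z x = S.
  rewrite /Z /S; under eq_bigr do rewrite mulr_sumr.
  rewrite exchange_big; apply: eq_bigr => i _; rewrite /p [RHS]big_mkcond.
  by apply: eq_bigr => x _; case: (A i x); rewrite ?mulr1 ?mulr0.
have EZ2 : \sum_x mu x * Z x ^+ 2 = \sum_i \sum_j \sum_(x | A i x && A j x) mu x.
  have h x : mu x * Z x ^+ 2 = \sum_i \sum_j (if A i x && A j x then mu x else 0).
    rewrite expr2 {1}/Z mulr_suml mulr_sumr; apply: eq_bigr => i _.
    rewrite /Z !mulr_sumr; apply: eq_bigr => j _.
    by case: (A i x); case: (A j x); rewrite ?(mulr1,mulr0,mul0r).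
  under eq_bigr do rewrite h.
  rewrite exchange_big; apply: eq_bigr => i _; rewrite exchange_big.
  by apply: eq_bigr => j _; rewrite [RHS]big_mkcond.
have p1 i : p i <= 1.
  by rewrite -mu1 [leRHS](bigID (A i)) lerDl sumr_ge0.
have p0 i : 0 <= p i by rewrite sumr_ge0.
have EZ2b : \sum_x mu x * Z x ^+ 2 <= S ^+ 2 + #|I|%:R + #|I|%:R ^+ 2 * eta.
  rewrite EZ2.
  apply: (@le_trans _ _ (\sum_i \sum_j (p i * p j + (i == j)%:R + eta))).
    apply: ler_sum => i _; apply: ler_sum => j _.
    have [<-|ij] := eqVneq i j; last by rewrite addr0; exact: cov.
    rewrite (eq_bigl (A i)) => [|x]; last by rewrite andbb.
    by rewrite mulr1n; have := p1 i; have := mulr_ge0 (p0 i) (p0 i); rewrite /p; lra.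
  have -> : \sum_i \sum_j (p i * p j + (i == j)%:R + eta) =
    \sum_i (p i * S + 1 + #|I|%:R * eta).
    apply: eq_bigr => i _; rewrite !big_split /= -mulr_sumr.
    congr (_ + _ + _); last by rewrite sumr_const mulr_natl.
    by rewrite (bigD1 i) //= eqxx big1 ?addr0 // => j /negPf; rewrite eq_sym => ->.
  rewrite !big_split /= -mulr_suml -/S !sumr_const -(mulr_natl (_ * eta)).
  by rewrite expr2 mulrA expr2.
have SN : #|I|%:R * delta <= S.
  by rewrite mulr_natl -sumr_const; apply: ler_sum => i _; exact: lb.
have sq : S ^+ 2 * \sum_(x | [forall i, ~~ A i x]) mu x <=
    \sum_x mu x * (Z x - S) ^+ 2.
  rewrite mulr_sumr [leLHS]big_mkcond; apply: ler_sum => x _.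
  case: forallP => [nA|_]; last by rewrite mulr_ge0 ?sqr_ge0.
  have -> : Z x = 0 by rewrite /Z big1 // => i _; rewrite (negbTE (nA i)).
  by rewrite sub0r sqrrN mulrC.
have var : \sum_x mu x * (Z x - S) ^+ 2 = \sum_x mu x * Z x ^+ 2 - S ^+ 2.
  have h x : mu x * (Z x - S) ^+ 2 =
    mu x * Z x ^+ 2 - 2 * S * (mu x * Z x) + S ^+ 2 * mu x by ring.
  rewrite (eq_bigr _ (fun x _ => h x)).
  by rewrite !big_split /= sumrN -!mulr_sumr EZ mu1; ring.
have q0 : 0 <= \sum_(x | [forall i, ~~ A i x]) mu x by rewrite sumr_ge0.
have : (#|I|%:R * delta) ^+ 2 * \sum_(x | [forall i, ~~ A i x]) mu x <=
  S ^+ 2 * \sum_(x | [forall i, ~~ A i x]) mu x.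
  rewrite ler_wpM2r // ler_sqr ?nnegrE //; first by rewrite mulr_ge0 // ltW.
  by rewrite sumr_ge0.
lra.
Qed.

Lemma finite_range_measurable d (T : measurableType d) (I : finType)
    (f : T -> I) (S : pred I) :
  (forall i, measurable [set w | f w = i]) -> measurable [set w | S (f w)].
Proof.
move=> mf.
have -> : [set w | S (f w)] = \bigcup_(i in [set i | S i]) [set w | f w = i].
  by apply/seteqP; split=> [w Sw|w [i /= Si ->]] //; exists (f w).
by apply: fin_bigcup_measurable => //; exact: finite_finset.
Qed.

Lemma prob_finite_range d (T : measurableType d) (R : realType)
    (P : probability T R) (I : finType) (f : T -> I) (S : pred I) :
  (forall i, measurable [set w | f w = i]) ->
  P [set w | S (f w)] = (\sum_(i | S i) P [set w | f w = i])%E.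
Proof.
move=> mf.
have -> : [set w | S (f w)] = \bigcup_(i in [set i | S i]) [set w | f w = i].
  by apply/seteqP; split=> [w Sw|w [i /= Si ->]] //; exists (f w).
rewrite measure_fin_bigcup //; first 1 last.
- exact: finite_finset.
- by move=> i j _ _ [w [/= <- <-]].
rewrite (fsbigE [seq i <- index_enum I | S i]) ?filter_uniq ?index_enum_uniq //.
- rewrite big_filter_cond; apply: eq_bigl => i.
  by apply/andP/idP => [[//]|Si]; split=> //; rewrite inE.
- by move=> i /=; rewrite mem_filter => /andP[].
- by move=> i /= Si; rewrite mem_filter Si mem_index_enum.
Qed.

Lemma measurable_forallN d (T : measurableType d) (I : finType)
    (B : I -> pred T) :
  (forall i, measurable [set w | B i w]) ->
  measurable [set w | [forall i, ~~ B i w]].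
Proof.
move=> mB.
rewrite (_ : [set w | _] = \bigcap_(i in [set: I]) ~` [set w | B i w]).
  by apply: fin_bigcap_measurable => // i _; exact: measurableC.
apply/seteqP; split=> w /=; first by move=> /forallP h i _; exact/negP.
by move=> h; apply/forallP => i; apply/negP; exact: h.
Qed.

(** The random set of the indices whose event occurs takes finitely many values;
    its law reduces the claim to [second_moment]. *)
Lemma prob_second_moment d (T : measurableType d) (R : realType)
    (P : probability T R) (I : finType) (A : I -> pred T) (delta eta : R) :
  (forall i, measurable [set w | A i w]) -> 0 < delta -> 0 <= eta ->
  (forall i, (delta%:E <= P [set w | A i w])%E) ->
  (forall i j, i != j -> (P [set w | A i w && A j w] <=
     P [set w | A i w] * P [set w | A j w] + eta%:E)%E) ->
  (((#|I|%:R * delta) ^+ 2)%:E * P [set w | [forall i, ~~ A i w]] <=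
    (#|I|%:R + #|I|%:R ^+ 2 * eta)%:E)%E.
Proof.
move=> mA d0 eta0 lb cov.
pose f w : {set I} := [set i | A i w]%SET.
have fE i w : (i \in f w) = A i w by rewrite inE.
have mf J : measurable [set w | f w = J].
  rewrite (_ : [set w | _] = \bigcap_(i in [set: I]) [set w | A i w = (i \in J)]).
    apply: fin_bigcap_measurable => // i _.
    case: (i \in J); first exact: mA.
    rewrite (_ : [set w | _] = ~` [set w | A i w]); first exact: measurableC.
    by apply/seteqP; split=> w /= => [->|/negP/negbTE].
  apply/seteqP; split=> w /= => [<- i _|h]; first by rewrite /= fE.
  by apply/setP => i; rewrite fE; exact: h.
pose mu J := fine (P [set w | f w = J]).
have muE J : P [set w | f w = J] = (mu J)%:E by rewrite fineK // fin_num_measure.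
have PE (S : pred {set I}) (B : set T) : B = [set w | S (f w)] ->
    P B = (\sum_(J | S J) mu J)%:E.
  move=> ->; rewrite prob_finite_range // -sumEFin.
  by apply: eq_bigr => J _; rewrite muE.
have PA i : P [set w | A i w] = (\sum_(J : {set I} | i \in J) mu J)%:E.
  by apply: PE; apply/seteqP; split=> w /=; rewrite fE.
rewrite (PE (fun J : {set I} => [forall i, i \notin J])); last first.
  by apply/seteqP; split=> w /= /forallP h; apply/forallP => i;
    have := h i; rewrite fE.
rewrite -EFinM lee_fin.
apply: (@second_moment R I {set I} mu (fun i J => i \in J) delta) => //.
- by move=> J; rewrite /mu fine_ge0.
- apply: EFin_inj; rewrite -(PE predT setT) ?probability_setT //.
  by apply/seteqP; split.
- by move=> i; rewrite -lee_fin -PA.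
- move=> i j /cov; rewrite !PA -EFinM -EFinD.
  rewrite (PE (fun J : {set I} => (i \in J) && (j \in J))) ?lee_fin //.
  by apply/seteqP; split=> w /=; rewrite !fE.
Qed.

(** * The law of the counts *)

(** The probability that a point has membership [x.1] in the smaller and [x.2] in
    the larger of two nested sets of probabilities [p] and [q]. *)
Definition cell_weight (R : realType) (p q : R) (x : bool * bool) : R :=
  if x.1 then (if x.2 then p else 0) else (if x.2 then q - p else 1 - q).

(** The explicit formula for [nested_mean], as a sum over the membership patterns
    of the whole sample. *)
Lemma nested_mean_tuple (R : realType) (p q : R) n (F : nat -> nat -> R) :
  \sum_(t : n.-tuple (bool * bool)) (\prod_(x <- t) cell_weight p q x) *
    F (count fst t) (count snd t) = nested_mean p q n F.
Proof.
elim: n F => [|n IH] F /=.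
  rewrite (bigD1 [tuple]) //= big_nil mul1r big1 ?addr0 // => t.
  by move=> /negP[]; rewrite [t]tuple0.
rewrite (reindex (fun u : (bool * bool) * n.-tuple (bool * bool) =>
    [tuple of u.1 :: u.2])) /=; last first.
  exists (fun t => (thead t, [tuple of behead t])) => [[x t] _|t _] /=.
    by congr pair; apply: val_inj.
  by rewrite [RHS]tuple_eta.
rewrite -(pair_big predT predT (fun x (t : n.-tuple (bool * bool)) =>
  (\prod_(y <- x :: t) cell_weight p q y) *
  F (x.1 + count fst t)%N (x.2 + count snd t)%N)) /=.
have h (x : bool * bool) : \sum_(t : n.-tuple (bool * bool))
    (\prod_(y <- x :: t) cell_weight p q y) *
      F (x.1 + count fst t)%N (x.2 + count snd t)%N =
    cell_weight p q x * nested_mean p q n (fun a b => F (x.1 + a)%N (x.2 + b)%N).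
  rewrite -IH mulr_sumr; apply: eq_bigr => t _.
  by rewrite big_cons mulrA.
rewrite (eq_bigr _ (fun x _ => h x)).
rewrite -(pair_big predT predT (fun a b : bool => cell_weight p q (a, b) *
  nested_mean p q n (fun a' b' => F (a + a')%N (b + b')%N))) /=.
by rewrite !big_bool /= /cell_weight /= mul0r !addr0 -addrA.
Qed.

Lemma measurable_cell (R : realType) (b b' : pred R) (u : bool * bool) :
  measurable [set x | b x] -> measurable [set x | b' x] ->
  measurable [set x | (b x, b' x) = u].
Proof.
move=> mb mb'.
have mE (c : pred R) (v : bool) : measurable [set x | c x] -> measurable [set x | c x = v].
  move=> mc; case: v => //.
  rewrite (_ : [set x | c x = false] = ~` [set x | c x]); first exact: measurableC.
  by apply/seteqP; split=> x /= => [->|/negP/negbTE].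
rewrite (_ : [set x | _] = [set x | b x = u.1] `&` [set x | b' x = u.2]).
  by apply: measurableI; exact: mE.
by apply/seteqP; split=> x /= => [<-//|[-> ->]]; case: u.
Qed.

Lemma prob_cell d (T : measurableType d) (R : realType) (P : probability T R)
    (Y : {RV P >-> R}) (b b' : pred R) (p q : R) (u : bool * bool) :
  measurable [set x | b x] -> measurable [set x | b' x] ->
  (forall x, b x -> b' x) ->
  P (Y @^-1` [set x | b x]) = p%:E -> P (Y @^-1` [set x | b' x]) = q%:E ->
  P (Y @^-1` [set x | (b x, b' x) = u]) = (cell_weight p q u)%:E.
Proof.
move=> mb mb' bb' hp hq.
have mY (B : set R) : measurable B -> measurable (Y @^-1` B).
  by move=> mB; rewrite -[_ @^-1` _]setTI; exact: measurable_funPT.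
have mYb := mY _ mb; have mYb' := mY _ mb'.
case: u => [[] []]; rewrite /cell_weight /=.
- rewrite -hp; congr (P _); apply/seteqP; split=> w /=; first by case.
  by move=> bw; rewrite bw bb'.
- rewrite (_ : _ @^-1` _ = set0) ?measure0 //.
  by apply/seteqP; split=> w //= [/bb' ->].
- rewrite (_ : _ @^-1` _ = (Y @^-1` [set x | b' x]) `\` (Y @^-1` [set x | b x])).
    have fin : (P (Y @^-1` [set x | b' x]) < +oo)%E by rewrite hq ltry.
    rewrite measureD // (_ : _ `&` _ = Y @^-1` [set x | b x]).
      by rewrite EFinB -hp -hq.
    by apply/seteqP; split=> w /= => [[]//|bw]; split=> //; exact: bb'.
  apply/seteqP; split=> w /=; first by case=> -> ->.
  by move=> [-> /negP/negbTE ->].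
- rewrite (_ : _ @^-1` _ = ~` (Y @^-1` [set x | b' x])).
    by rewrite probability_setC ?hq.
  apply/seteqP; split=> w /=; first by case=> _ ->.
  by move=> /negP b'w; rewrite (negbTE b'w) (contraNF (@bb' _) b'w).
Qed.

Section pattern.
Variables (d : measure_display) (T : measurableType d) (R : realType).
Variables (P : probability T R) (n : nat) (X : 'I_n -> {RV P >-> R}).
Variables (b b' : pred R).
Hypotheses (mb : measurable [set x | b x]) (mb' : measurable [set x | b' x]).

Let pattern w : n.-tuple (bool * bool) := [tuple (b (X j w), b' (X j w)) | j < n].

Let pattern_eq (t : n.-tuple (bool * bool)) : [set w | pattern w = t] =
  \bigcap_(i in [set: 'I_n]) X i @^-1` [set x | (b x, b' x) = tnth t i].
Proof.
apply/seteqP; split=> w /= => [<- i _|h]; first by rewrite tnth_mktuple.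
by apply: eq_from_tnth => i; rewrite tnth_mktuple; exact: h.
Qed.

Let measurable_pattern (t : n.-tuple (bool * bool)) :
  measurable [set w | pattern w = t].
Proof.
rewrite pattern_eq; apply: fin_bigcap_measurable => // i _.
rewrite -[_ @^-1` _]setTI; apply: measurable_funPT => //.
exact: measurable_cell.
Qed.

Let count_pattern (phi : nat -> nat -> bool) :
  [set w | phi (count (fun j => b (X j w)) (enum 'I_n))
               (count (fun j => b' (X j w)) (enum 'I_n))] =
  [set w | phi (count fst (pattern w)) (count snd (pattern w))].
Proof. by apply/seteqP; split=> w /=; rewrite !count_map. Qed.

Lemma measurable_counts (phi : nat -> nat -> bool) :
  measurable [set w | phi (count (fun j => b (X j w)) (enum 'I_n))
                          (count (fun j => b' (X j w)) (enum 'I_n))].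
Proof.
rewrite count_pattern.
exact: (@finite_range_measurable _ _ _ pattern
  (fun t => phi (count fst t) (count snd t))).
Qed.

(** The joint law of the counts depends on the sample only through [p] and [q]:
    this is what carries local levels computed on one probability space over to
    another one. *)
Lemma prob_counts (p q : R) (phi : nat -> nat -> bool) :
  mutually_independent X -> (forall x, b x -> b' x) ->
  (forall i, P (X i @^-1` [set x | b x]) = p%:E) ->
  (forall i, P (X i @^-1` [set x | b' x]) = q%:E) ->
  P [set w | phi (count (fun j => b (X j w)) (enum 'I_n))
                 (count (fun j => b' (X j w)) (enum 'I_n))] =
  (nested_mean p q n (fun a c => (phi a c)%:R))%:E.
Proof.
move=> iX bb' hp hq; rewrite count_pattern.
rewrite (@prob_finite_range _ _ _ _ _ pattern
  (fun t => phi (count fst t) (count snd t))) // -nested_mean_tuple.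
have h (t : n.-tuple (bool * bool)) :
    P [set w | pattern w = t] = (\prod_(x <- t) cell_weight p q x)%:E.
  rewrite pattern_eq big_tuple -prodEFin.
  have := iX [set: 'I_n]%SET (fun i => [set x | (b x, b' x) = tnth t i]).
  move=> /(_ (fun i => measurable_cell _ mb mb')).
  rewrite (_ : [set w | _] = \bigcap_(i in [set: 'I_n])
      X i @^-1` [set x | (b x, b' x) = tnth t i]); last first.
    by apply/seteqP; split=> w /= h i => [_|ii]; apply: h; rewrite ?inE.
  move=> ->; apply: eq_big => [i|i _]; first by rewrite inE.
  exact: prob_cell.
rewrite (eq_bigr _ (fun t _ => h t)) sumEFin big_mkcond; congr (_%:E).
by apply: eq_bigr => t _; case: ifP => _; rewrite ?mulr1 ?mulr0.
Qed.

End pattern.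

(** * Order statistics and crossings *)

Lemma order_stat_le (R : realType) n (x : 'I_n -> R) (i : 'I_n) (c : R) :
  (order_stat x i <= c) = (i < count (fun j => x j <= c)%R (enum 'I_n))%N.
Proof.
rewrite /order_stat; set s := [seq x j | j <- enum 'I_n].
have -> : count (fun j => x j <= c) (enum 'I_n) = count (<= c) (sort <=%R s).
  by have /seq.permP -> := permEl (perm_sort <=%R s); rewrite /s [RHS]count_map.
have so : sorted <=%R (sort <=%R s) by apply: sort_sorted; exact: le_total.
case: ltnP => h; first exact: nth_count_le.
apply/negbTE; rewrite -ltNge; apply: nth_count_gt => //.
by rewrite h size_sort size_map size_enum_ord ltn_ord.
Qed.

Lemma order_stat_ge (R : realType) n (x : 'I_n -> R) (i : 'I_n) (c : R) :
  (c <= order_stat x i) = (count (fun j => x j < c)%R (enum 'I_n) <= i)%N.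
Proof.
rewrite /order_stat; set s := [seq x j | j <- enum 'I_n].
have -> : count (fun j => x j < c) (enum 'I_n) = count (< c) (sort <=%R s).
  by have /seq.permP -> := permEl (perm_sort <=%R s); rewrite /s [RHS]count_map.
have so : sorted <=%R (sort <=%R s) by apply: sort_sorted; exact: le_total.
case: leqP => h.
  apply: nth_count_ge => //.
  by rewrite h size_sort size_map size_enum_ord ltn_ord.
by apply/negbTE; rewrite -ltNge; apply: nth_count_lt.
Qed.

(** Both kinds of critical values reject on equality. A lower one, [s = true],
    compares the order statistic with [t] through the number of points in the
    closed half-line; for an upper one, [s = false], rejection is the complement
    of an event on the number of points in the open half-line. *)
Definition below (R : realType) (s : bool) (t : R) : pred R :=
  fun x => if s then x <= t else x < t.

(** The rejection event of one critical value [t] for the order statistic of rank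
    [r], counted from 1: at least [r] points are below [t] when [s] is [true],
    fewer than [r] when [s] is [false]. *)
Definition crossing (R : realType) n (s : bool) (t : R) (r : nat)
    (x : 'I_n -> R) : bool :=
  (r <= count (fun j => below s t (x j)) (enum 'I_n))%N == s.

Lemma crossing_order_stat (R : realType) n (s : bool) (t : R) (x : 'I_n -> R)
    (i : 'I_n) :
  crossing s t i.+1 x = if s then order_stat x i <= t else t <= order_stat x i.
Proof.
rewrite /crossing; case: s; first by rewrite order_stat_le eqb_id.
by rewrite order_stat_ge eqbF_neg -ltnNge.
Qed.

Lemma crossing_mono (R : realType) n (s : bool) (t t' : R) (r : nat)
    (x : 'I_n -> R) :
  (if s then t' <= t else t <= t') -> crossing s t' r x -> crossing s t r x.
Proof.
rewrite /crossing; case: s => tt'; rewrite ?eqb_id ?eqbF_neg -?ltnNge => h.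
  by apply: leq_trans h _; apply: sub_count => j /= /le_trans ->.
by apply: leq_ltn_trans h; apply: sub_count => j /= /lt_le_trans ->.
Qed.

Lemma measurable_below (R : realType) (s : bool) (t : R) :
  measurable [set x | below s t x].
Proof.
case: s; rewrite /below.
  rewrite (_ : [set x | _] = [set` `]-oo, t]]); first exact: measurable_itv.
  by apply/seteqP; split=> x /=; rewrite in_itv.
rewrite (_ : [set x | _] = [set` `]-oo, t[]); first exact: measurable_itv.
by apply/seteqP; split=> x /=; rewrite in_itv.
Qed.

Lemma uniform_below (R : realType) (s : bool) (t : R) : 0 <= t <= 1 ->
  uniform_prob (@ltr01 R) [set x | below s t x] = t%:E.
Proof.
move=> t01; have [t0 t1] := andP t01.
rewrite /uniform_prob integral_uniform_pdf.
rewrite (eq_integral (fun=> 1%:E)); last first.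
  move=> x; rewrite inE => -[_ /=]; rewrite in_itv /= /uniform_pdf => ->.
  by rewrite subr0 invr1.
have -> : [set x | below s t x] `&` [set` `[0 : R, 1]] =
    [set` Interval (BLeft 0) (BSide (~~ s) t)].
  apply/seteqP; split=> x /=; rewrite !in_itv /= /below; case: s => /=.
  - by case=> -> /andP[->].
  - by case=> -> /andP[->].
  - by move=> /andP[-> xt]; rewrite xt (le_trans xt).
  - by move=> /andP[-> xt]; rewrite xt (le_trans (ltW xt)).
rewrite integral_cst /=; last exact: measurable_itv.
rewrite mul1e lebesgue_measure_itv /= lte_fin.
by case: ltP => [_|t0']; rewrite ?sube0 // (@le_anti _ _ t 0) ?t0'.
Qed.

Section crossing_prob.
Variables (d : measure_display) (T : measurableType d) (R : realType).
Variables (P : probability T R) (n : nat) (X : 'I_n -> {RV P >-> R}).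

Lemma measurable_crossing s (t : R) r :
  measurable [set w | crossing s t r (fun j => X j w)].
Proof.
exact: (measurable_counts X (measurable_below s t) (measurable_below s t)
  (fun a _ => (r <= a)%N == s)).
Qed.

Hypothesis iidX : iid_uniform01 X.

Lemma prob_below s (t : R) i : 0 <= t <= 1 ->
  P (X i @^-1` [set x | below s t x]) = t%:E.
Proof.
move=> t01; rewrite -(uniform_below s t01).
exact: iidX.2 i _ (measurable_below s t).
Qed.

Lemma prob_crossing s (t : R) r : 0 <= t <= 1 ->
  P [set w | crossing s t r (fun j => X j w)] =
  (bin_mean t n (fun k => ((r <= k)%N == s)%:R))%:E.
Proof.
move=> t01; rewrite -(nested_meanl t t).
apply: (prob_counts (measurable_below s t) (measurable_below s t)
  (fun a _ => (r <= a)%N == s) iidX.1) => // i; exact: prob_below.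
Qed.

(** Two crossings are nearly uncorrelated, whatever their kinds, when their
    thresholds are far apart in ratio. *)
Lemma prob_crossing2 s s' (t t' rho : R) r r' :
  0 <= t <= 1 -> 0 <= t' <= 1 -> t < t' -> 0 < rho -> t <= rho ^+ 2 * t' ->
  (P [set w | crossing s t r (fun j => X j w) &&
     crossing s' t' r' (fun j => X j w)] <=
  (bin_mean t n (fun k => ((r <= k)%N == s)%:R) *
   bin_mean t' n (fun k => ((r' <= k)%N == s')%:R) + rho)%:E)%E.
Proof.
move=> t01 t'01 tt' rho0 rtt'; have [t0 _] := andP t01; have [_ t'1] := andP t'01.
(* Strictness of [t < t'] nests the half-lines whatever their kinds. *)
have bb' x : below s t x -> below s' t' x.
  have le_t : below s t x -> x <= t by rewrite /below; case: s => // /ltW.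
  move=> /le_t xt; have xt' := le_lt_trans xt tt'.
  by rewrite /below; case: s' => //; exact: ltW.
rewrite (prob_counts (measurable_below s t) (measurable_below s' t')
  (fun a b => ((r <= a)%N == s) && ((r' <= b)%N == s')) iidX.1 bb'
  (fun i => prob_below s i t01) (fun i => prob_below s' i t'01)).
rewrite lee_fin; apply: (nested_cov_ind _ (fun k => (r <= k)%N == s)
  (fun k => (r' <= k)%N == s')) => //.
by rewrite t0 ltW.
Qed.

End crossing_prob.

(** * Almost certain rejection *)

(** Balanced thresholds at the ranks [M ^ j < M ^ k] have a ratio of order
    [M ^ (k - j)], so a large [M] separates them as much as desired. *)
Lemma geometric_separation (R : realType) (delta rho x t t' : R) (M j k : nat) :
  0 < delta -> 0 < rho -> 4 / (delta ^+ 2 * rho ^+ 2) <= M%:R ->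
  (0 < M)%N -> (j < k)%N -> 0 < x ->
  delta * (x * t) <= 4 * (M ^ j)%:R -> delta * (M ^ k)%:R <= x * t' ->
  t <= rho ^+ 2 * t'.
Proof.
move=> d0 r0 hM M0 jk x0 ht ht'.
have a0 : 0 < (M ^ j)%:R :> R by rewrite ltr0n expn_gt0 M0.
have dr0 : 0 < delta ^+ 2 * rho ^+ 2 by rewrite mulr_gt0 // exprn_gt0.
have h1 : 4 <= delta ^+ 2 * rho ^+ 2 * M%:R by rewrite mulrC -ler_pdivrMr.
have h2 : (M ^ j)%:R * M%:R <= (M ^ k)%:R :> R.
  by rewrite -natrM ler_nat -expnSr leq_pexp2l.
rewrite -(ler_pM2l (mulr_gt0 d0 x0)).
have e1 : delta * x * t <= 4 * (M ^ j)%:R by rewrite -mulrA.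
apply: (le_trans e1).
have e2 : delta * rho ^+ 2 * (delta * (M ^ k)%:R) <= delta * rho ^+ 2 * (x * t').
  by apply: ler_wpM2l => //; apply/ltW; rewrite mulr_gt0 // exprn_gt0.
have e3 : delta ^+ 2 * rho ^+ 2 * ((M ^ j)%:R * M%:R) <=
    delta ^+ 2 * rho ^+ 2 * (M ^ k)%:R by rewrite ler_wpM2l // ltW.
have e4 : (M ^ j)%:R * 4 <= (M ^ j)%:R * (delta ^+ 2 * rho ^+ 2 * M%:R).
  by rewrite ler_wpM2l // ltW.
lra.
Qed.

(** Among the [n] events only those of the ranks [M ^ k], [k < m], are used, where
    [m] and [M] depend on [delta] and [eps] alone. Their balanced versions have
    pairwise covariances at most [rho], so that all of them fail with probability
    at most [(1 / m + rho) / delta ^ 2]; the choices of [rho] and [m] make each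
    of the two terms at most [eps / 2]. *)
Lemma crossing_unavoidable (R : realType) (delta eps : R) :
  0 < delta <= 1 / 2 -> 0 < eps <= 1 ->
  exists N, forall n, (N <= n)%N ->
  forall d (T : measurableType d) (P : probability T R)
    (X : 'I_n -> {RV P >-> R}) (s : 'I_n -> bool) (t : 'I_n -> R),
  iid_uniform01 X -> (forall i, 0 <= t i <= 1) ->
  (forall i, (delta%:E <=
     P [set w | crossing (s i) (t i) i.+1 (fun j => X j w)])%E) ->
  (P [set w | [forall i : 'I_n,
     ~~ crossing (s i) (t i) i.+1 (fun j => X j w)]] <= eps%:E)%E.
Proof.
move=> d01 /andP[e0 e1]; have [d0 d1] := andP d01.
pose rho := eps * delta ^+ 2 / 2.
have r0 : 0 < rho by rewrite !mulr_gt0 ?invr_gt0 ?exprn_gt0.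
have r1 : rho < 1 by rewrite /rho; nra.
pose M := (Num.truncn (4 / (delta ^+ 2 * rho ^+ 2))).+1.
pose m := (Num.truncn (2 / (eps * delta ^+ 2))).+1.
have hM : 4 / (delta ^+ 2 * rho ^+ 2) <= M%:R by exact/ltW/truncnS_gt.
have hm : 2 / (eps * delta ^+ 2) <= m%:R by exact/ltW/truncnS_gt.
(* The factor 4 is the room that [balanced_threshold] needs above each rank. *)
exists (4 * M ^ m)%N => n Nn d T P X s t iX t01 lb.
have r_gt0 k : (0 < M ^ k)%N by rewrite expn_gt0.
have r_le (k : 'I_m) : (4 * M ^ k <= n)%N.
  by apply: leq_trans Nn; rewrite leq_mul2l leq_pexp2l // ltnW.
have r_lt (k : 'I_m) : ((M ^ k).-1 < n)%N.
  rewrite prednK //; apply: leq_trans (r_le k); exact: leq_pmull.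
pose i_ (k : 'I_m) := Ordinal (r_lt k).
have rE k : (i_ k).+1 = (M ^ k)%N by rewrite /= prednK.
have n0 : 0 < n%:R :> R by rewrite ltr0n; exact: leq_ltn_trans (r_lt ord0).
(* Balanced versions of the critical values at the ranks [M ^ k]. *)
have /choice[t' ht'] (k : 'I_m) : exists u : R, [/\ 0 <= u <= 1,
    if s (i_ k) then u <= t (i_ k) else t (i_ k) <= u,
    delta <= bin_mean u n (fun a => ((M ^ k <= a)%N == s (i_ k))%:R),
    delta * (M ^ k)%:R <= n%:R * u & delta * (n%:R * u) <= 4 * (M ^ k)%:R].
  apply: balanced_threshold (t01 (i_ k)) _ _ => //.
  by rewrite -lee_fin -(prob_crossing iX) ?t01 // -rE.
pose A (k : 'I_m) w := crossing (s (i_ k)) (t' k) (M ^ k) (fun j => X j w).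
have mA k : measurable [set w | A k w] by exact: measurable_crossing.
have PA k : P [set w | A k w] =
    (bin_mean (t' k) n (fun a => ((M ^ k <= a)%N == s (i_ k))%:R))%:E.
  by apply: prob_crossing => //; case: (ht' k).
have cov (j k : 'I_m) : (j < k)%N ->
    (P [set w | A j w && A k w] <=
     P [set w | A j w] * P [set w | A k w] + rho%:E)%E.
  move=> jk; rewrite !PA -EFinM -EFinD.
  have [j1 _ _ _ j2] := ht' j; have [k1 _ _ k2 _] := ht' k.
  have sep : t' j <= rho ^+ 2 * t' k.
    exact: (geometric_separation d0 r0 hM _ jk n0 j2 k2).
  apply: prob_crossing2 => //; apply: le_lt_trans sep _.
  have t'k0 : 0 < t' k.
    rewrite -(pmulr_rgt0 _ n0); apply: lt_le_trans k2.
    by rewrite mulr_gt0 // ltr0n.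
  by rewrite -[ltRHS]mul1r ltr_pM2r // exprn_ilt1 // ltW.
have sub : [set w | [forall i, ~~ crossing (s i) (t i) i.+1 (fun j => X j w)]]
    `<=` [set w | [forall k, ~~ A k w]].
  move=> w /= /forallP h; apply/forallP => k; apply: contra (h (i_ k)).
  by rewrite rE; apply: crossing_mono; case: (ht' k).
apply: (@le_trans _ _ (P [set w | [forall k, ~~ A k w]])).
  apply: le_measure => //; rewrite inE; last exact: measurable_forallN.
  apply: (@measurable_forallN _ _ _
    (fun i w => crossing (s i) (t i) i.+1 (fun j => X j w))) => i.
  exact: measurable_crossing.
have lbA k : (delta%:E <= P [set w | A k w])%E.
  by rewrite PA lee_fin; case: (ht' k).
have := prob_second_moment mA d0 (ltW r0) lbA.
have covA j k : j != k -> (P [set w | A j w && A k w] <=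
     P [set w | A j w] * P [set w | A k w] + rho%:E)%E.
  rewrite neq_ltn => /orP[|kj]; first exact: cov.
  rewrite muleC (_ : [set w | _] = [set w | A k w && A j w]); first exact: cov.
  by apply/seteqP; split=> w /=; rewrite andbC.
move=> /(_ covA); rewrite card_ord.
have finC : P [set w | [forall k, ~~ A k w]] \is a fin_num.
  by apply: fin_num_measure; exact: measurable_forallN.
rewrite -(fineK finC); set Q := fine _ => hQ; rewrite lee_fin.
rewrite -EFinM lee_fin in hQ.
have m_gt0 : 0 < m%:R :> R by rewrite ltr0n.
have hm' : 2 <= m%:R * (eps * delta ^+ 2).
  by rewrite -ler_pdivrMr // mulr_gt0 // exprn_gt0.
rewrite -(ler_pM2l (_ : 0 < (m%:R * delta) ^+ 2)) ?exprn_gt0 ?mulr_gt0 //.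
apply: (le_trans hQ).
have : m%:R * 2 <= m%:R * (m%:R * (eps * delta ^+ 2)) by rewrite ler_wpM2l // ltW.
rewrite /rho exprMn; lra.
Qed.

Lemma expected_testE (R : realType) d (T : measurableType d)
    (P : probability T R) n (X : 'I_n -> {RV P >-> R}) (phi : ('I_n -> R) -> bool) :
  measurable [set w | phi (fun j => X j w)] ->
  expected_test X phi = P [set w | phi (fun j => X j w)].
Proof.
move=> mphi; rewrite -expectation_indic //; congr expectation.
apply/funext => w; rewrite indicE; congr ((nat_of_bool _)%:R); apply/esym.
by apply/idP/idP; rewrite inE.
Qed.

(** The form of [crossing_unavoidable] that applies to every test rejecting as soon
    as one of the crossings occurs, in particular to a two-sided test when only
    one side is kept for each index. *)
Lemma rejection_near_one (R : realType) (delta eps : R) :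
  0 < delta <= 1 / 2 -> 0 < eps <= 1 ->
  exists N, forall n, (N <= n)%N ->
  forall d (T : measurableType d) (P : probability T R)
    (X : 'I_n -> {RV P >-> R}) (s : 'I_n -> bool) (t : 'I_n -> R)
    (phi : ('I_n -> R) -> bool),
  iid_uniform01 X -> (forall i, 0 <= t i <= 1) ->
  measurable [set w | phi (fun j => X j w)] ->
  (forall i x, crossing (s i) (t i) i.+1 x -> phi x) ->
  (forall i, delta <= bin_mean (t i) n
     (fun k => ((i.+1 <= k)%N == s i)%:R)) ->
  ((1 - eps)%:E <= expected_test X phi)%E.
Proof.
move=> d01 e01; have [N hN] := crossing_unavoidable d01 e01.
exists N => n Nn d T P X s t phi iX t01 mphi cphi lb.
rewrite expected_testE // -[X in (_ <= P X)%E]setCK probability_setC; last first.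
  exact: measurableC.
rewrite EFinB leeB //; apply: le_trans (hN n Nn d T P X s t iX t01 _); last first.
  by move=> i; rewrite prob_crossing // lee_fin.
apply: le_measure; rewrite ?inE.
- exact: measurableC.
- apply: (@measurable_forallN _ _ _
    (fun i w => crossing (s i) (t i) i.+1 (fun j => X j w))) => i.
  exact: measurable_crossing.
- by move=> w /= nphi; apply/forallP => i; apply/negP => /cphi.
Qed.

(** Since [+oo] is neutral for the minimum, a lower bound on [min_level] is the
    same as a lower bound on all the levels: the first conclusion says that no
    [delta > 0] bounds all the levels from below for infinitely many [n], and
    the second one that none does from some [n] on. *)
Lemma min_level_cvg0 (R : realType) (a : forall n, 'I_n -> \bar R) :
  (forall n i, (0 <= a n i)%E) ->
  (forall delta : R, 0 < delta ->
     \forall n \near \oo, ~ (forall i : 'I_n, (delta%:E <= a n i)%E)) ->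
  min_level (a n) @[n --> \oo] --> 0%E /\ ~ asymptotically_bounded_away a.
Proof.
move=> a0 small; split; last first.
  move=> [delta delta0 hd]; have [N _ hN] := filterI hd (small _ delta0).
  by have [h1 h2] := hN N (leqnn N).
have m0 n : (0 <= min_level (a n))%E by apply/bigmin_geP; split.
have lt_m (e : R) : 0 < e -> \forall n \near \oo, (min_level (a n) < e%:E)%E.
  move=> e0; apply: filterS (small _ e0) => n; rewrite ltNge => h.
  apply/negP => /bigmin_geP[_ h']; apply: h => i; exact: h'.
apply/fine_cvgP; split.
  apply: filterS (lt_m 1 ltr01) => n h; rewrite ge0_fin_numE //.
  by apply: lt_trans h _; rewrite ltry.
apply/cvgrPdist_lt => e e0; apply: filterS (lt_m e e0) => n h.
rewrite sub0r normrN /= ger0_norm ?fine_ge0 // -lte_fin fineK //.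
by rewrite ge0_fin_numE //; apply: lt_trans h _; rewrite ltry.
Qed.

Lemma cvg_eventually_lt (R : realType) (u : nat -> \bar R) (a b : R) :
  u n @[n --> \oo] --> a%:E -> a < b -> \forall n \near \oo, (u n < b%:E)%E.
Proof.
move=> /fine_cvgP[fu cu] ab.
have lt_fine : \forall n \near \oo, fine (u n) < b by exact: (cvgr_lt _ cu).
by apply: filterS2 fu lt_fine => n fn h; rewrite -(fineK fn) lte_fin.
Qed.

(** * Local levels *)

Theorem mainTheorem2 (R : realType) (alpha : R) (halpha : 0 < alpha < 1)
    (dX : nat -> measure_display) (TX : forall n, measurableType (dX n))
    (PX : forall n, probability (TX n) R)
    (X : forall n, 'I_n -> {RV (PX n) >-> R})
    (hX : forall n, iid_uniform01 (X n))
    (dU : nat -> measure_display) (TU : forall n, measurableType (dU n))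
    (PU : forall n, probability (TU n) R)
    (U : forall n, 'I_n -> {RV (PU n) >-> R})
    (hU : forall n, iid_uniform01 (U n)) :
  (forall c : forall n, 'I_n -> R,
    (forall n, one_sided_critical (c n)) ->
    expected_test (X n) (one_sided_test (c n)) @[n --> \oo] --> alpha%:E ->
    min_level (local_level (U n) (c n)) @[n --> \oo] --> 0%E /\
    ~ asymptotically_bounded_away (fun n => local_level (U n) (c n)))
  /\
  (forall c c' : forall n, 'I_n -> R,
    (forall n, two_sided_critical (c n) (c' n)) ->
    expected_test (X n) (two_sided_test (c n) (c' n)) @[n --> \oo] -->
      alpha%:E ->
    min_level (local_level2 (U n) (c n) (c' n)) @[n --> \oo] --> 0%E /\
    ~ asymptotically_bounded_away (fun n => local_level2 (U n) (c n) (c' n))).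
Proof.
have [alpha0 alpha1] := andP halpha.
pose eps := (1 - alpha) / 2.
have e01 : 0 < eps <= 1 by apply/andP; split; rewrite /eps; lra.
have lt_eps : alpha < 1 - eps by rewrite /eps; lra.
pose half (delta : R) := Num.min delta 1 / 2.
have half01 delta : 0 < delta -> 0 < half delta <= 1 / 2.
  by move=> d0; rewrite /half; case: (leP delta 1) => h; apply/andP; split; lra.
have half_le delta : half delta *+ 2 <= delta.
  by rewrite -mulr_natr divfK // ge_min lexx.
have le_lower n (c : 'I_n -> R) i w :
    (order_stat (fun j => U n j w) i <= c i) =
    crossing true (c i) i.+1 (fun j => U n j w).
  by rewrite crossing_order_stat.
have le_upper n (c : 'I_n -> R) i w :
    (c i <= order_stat (fun j => U n j w) i) =
    crossing false (c i) i.+1 (fun j => U n j w).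
  by rewrite crossing_order_stat.
pose beta n s (c : 'I_n -> R) i : R :=
  bin_mean (c i) n (fun k => ((i.+1 <= k)%N == s)%:R).
have lowerE n (c : 'I_n -> R) i : 0 <= c i <= 1 ->
    PU n [set w | order_stat (fun j => U n j w) i <= c i] = (beta n true c i)%:E.
  move=> ci; rewrite -(prob_crossing (hU n)) //; congr (PU n _).
  by apply/seteqP; split=> w /=; rewrite le_lower.
have upperE n (c : 'I_n -> R) i : 0 <= c i <= 1 ->
    PU n [set w | c i <= order_stat (fun j => U n j w) i] = (beta n false c i)%:E.
  move=> ci; rewrite -(prob_crossing (hU n)) //; congr (PU n _).
  by apply/seteqP; split=> w /=; rewrite le_upper.
have mexists n (B : 'I_n -> pred (TX n)) : (forall i, measurable [set w | B i w]) ->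
    measurable [set w | [exists i, B i w]].
  move=> mB; rewrite (_ : [set w | _] = \bigcup_(i in [set: 'I_n]) [set w | B i w]).
    by apply: fin_bigcup_measurable.
  by apply/seteqP; split=> w /= => [/existsP[i Bi]|[i _ Bi]];
    [exists i | apply/existsP; exists i].
split=> [c hc cvgE | c c' hc cvgE]; apply: min_level_cvg0.
- by move=> n i; rewrite /local_level measure_ge0.
- move=> delta delta0; have [N hN] := rejection_near_one (half01 _ delta0) e01.
  have := cvg_eventually_lt cvgE lt_eps; apply: filterS2 (nbhs_infty_ge N).
  move=> n Nn small lb; move: small; apply/negP; rewrite -leNgt.
  have c01 i : 0 <= c n i <= 1.
    by have [/(_ i)/andP[-> /ltW ->] _] := hc n.
  apply: (hN n Nn _ _ _ (X n) (fun=> true) (c n)) => //.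
  + apply: mexists => i; rewrite (_ : [set w | _] =
      [set w | crossing true (c n i) i.+1 (fun j => X n j w)]).
      exact: measurable_crossing.
    by apply/seteqP; split=> w /=; rewrite crossing_order_stat.
  + by move=> i x; rewrite crossing_order_stat => h; apply/existsP; exists i.
  + move=> i; have := lb i; rewrite /local_level lowerE // lee_fin -/(beta n true (c n) i).
    by have := half_le delta; have := half01 _ delta0; rewrite mulr2n; lra.
- by move=> n i; rewrite /local_level2 adde_ge0.
- move=> delta delta0; have [N hN] := rejection_near_one (half01 _ delta0) e01.
  have := cvg_eventually_lt cvgE lt_eps; apply: filterS2 (nbhs_infty_ge N).
  move=> n Nn small lb; move: small; apply/negP; rewrite -leNgt.
  have [[c0 _] c'0 _ _] := hc n.
  have c01 i : 0 <= c n i <= 1 by have /andP[-> /ltW ->] := c0 i.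
  have c'01 i : 0 <= c' n i <= 1 by have /andP[/ltW -> ->] := c'0 i.
  (* One of the two sides carries at least half of the local level. *)
  pose s i := half delta <= beta n true (c n) i.
  pose t i := if s i then c n i else c' n i.
  apply: (hN n Nn _ _ _ (X n) s t) => //.
  + by move=> i; rewrite /t; case: ifP.
  + apply: mexists => i; rewrite (_ : [set w | _] =
      [set w | crossing true (c n i) i.+1 (fun j => X n j w)] `|`
      [set w | crossing false (c' n i) i.+1 (fun j => X n j w)]).
      by apply: measurableU; exact: measurable_crossing.
    by apply/seteqP; split=> w /=; rewrite !crossing_order_stat => /orP.
  + move=> i x; rewrite crossing_order_stat /t => h; apply/existsP; exists i.
    by move: h; case: (s i) => ->; rewrite ?orbT.
  + move=> i; have := lb i.
    rewrite /local_level2 lowerE // upperE // -EFinD lee_fin /t.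
    have [si|] := boolP (s i); first by [].
    rewrite -ltNge -/(beta n false (c' n) i).
    by have := half_le delta; rewrite mulr2n; lra.
Qed.
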